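(* For all positive integers $n$ and $\sigma$, $\mathit{SQ}'_{\mathrm{param}}(n,\sigma)\le 2\sigma!\,n$ and $\mathit{SQ}_{\mathrm{param}}(n,\sigma)\le 2(\sigma!)^2 n$.
   Context: Two words $u,v$ are equivalent in the parameterized sense if $|u|=|v|$ and there is a bijection $f:\mathrm{Alph}(u)\to\mathrm{Alph}(v)$ ($\mathrm{Alph}$ = set of letters occurring) with $v[t]=f(u[t])$ for all $t$. A parameterized square is a word $uv$ with $u,v$ nonempty and equivalent in the parameterized sense. $\mathit{SQ}_{\mathrm{param}}(n,\sigma)$ is the maximum, over words $w$ of length $n$ over an alphabet of size $\sigma$, of the number of subwords (contiguous factors) of $w$ that are parameterized squares, counted as distinct words; $\mathit{SQ}'_{\mathrm{param}}(n,\sigma)$ is the maximum over such $w$ of the number of pairwise parameterized-nonequivalent parameterized squares occurring as subwords of $w$. *)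

(* Defs.v *)
From mathcomp Require Import all_boot.

Set Implicit Arguments.
Unset Strict Implicit.
Unset Printing Implicit Defensive.

Section ParamSquares.
Variable T : finType.
Implicit Types u v w : seq T.

Definition Alph w : {set T} := [set x in w].

(* A bijection Alph u -> Alph v is represented by a total map on T that is
   injective on Alph u and sends Alph u onto Alph v; given equal lengths,
   v = map f u says v[t] = f(u[t]) at every position t. *)
Definition param_equiv u v : bool :=
  (size u == size v) &&
  [exists f : {ffun T -> T},
    [&& dinjectiveb f (mem (Alph u)), f @: Alph u == Alph v & v == map f u]].

Definition param_square w : bool :=
  [exists k : 'I_(size w).+1,
    [&& take k w != [::], drop k w != [::]
      & param_equiv (take k w) (drop k w)]].

Lemma param_equivP u v :
  reflect (size u = size v /\
           exists f : T -> T,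
             [/\ {in Alph u &, injective f}, f @: Alph u = Alph v
               & forall x0 t, t < size u -> nth x0 v t = f (nth x0 u t)])
          (param_equiv u v).
Proof.
apply: (iffP andP) => [[/eqP szE /existsP[f /and3P[/dinjectiveP fI /eqP fA /eqP vE]]]|].
  by split=> //; exists f; split=> // x0 t tu; rewrite vE (nth_map x0).
move=> [szE [f [fI fA fE]]]; split; first exact/eqP.
have fF : finfun f =1 f by move=> x; rewrite ffunE.
apply/existsP; exists (finfun f); apply/and3P; split.
- by apply/dinjectiveP => x y xu yu; rewrite !fF; apply: fI.
- by rewrite (eq_imset _ fF) fA.
- rewrite (eq_map fF); apply/eqP.
  case: u szE fI fA fE => [|x0 u] szE fI fA fE; first by case: v szE {fA fE}.
  apply: (@eq_from_nth _ x0) => [|i iv]; first by rewrite size_map.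
  by rewrite -szE in iv; rewrite fE // (nth_map x0).
Qed.

Lemma param_squareP w :
  reflect (exists u v, [/\ u <> [::], v <> [::], w = u ++ v & param_equiv u v])
          (param_square w).
Proof.
apply: (iffP existsP) => [[k /and3P[/eqP u0 /eqP v0 e]]|[u [v [u0 v0 -> e]]]].
  by exists (take k w), (drop k w); split; rewrite ?cat_take_drop.
have lt_u : size u < (size (u ++ v)).+1 by rewrite size_cat ltnS leq_addr.
exists (Ordinal lt_u); rewrite /= take_size_cat // drop_size_cat // e andbT.
by apply/andP; split; apply/eqP.
Qed.

(* Every factor of a word of length n has length at most n, hence lies in the
   finite type n.-bseq T. *)
Definition param_squares n (w : n.-tuple T) : {set n.-bseq T} :=
  [set x : n.-bseq T | infix x w & param_square x].

Definition pairwise_nonequiv n (A : {set n.-bseq T}) : bool :=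
  [forall x in A, forall y in A, (x != y) ==> ~~ param_equiv x y].

End ParamSquares.

Definition SQ_param (n sigma : nat) : nat :=
  \max_(w : n.-tuple 'I_sigma) #|param_squares w|.

Definition SQ'_param (n sigma : nat) : nat :=
  \max_(w : n.-tuple 'I_sigma)
    \max_(A : {set n.-bseq 'I_sigma} |
          (A \subset param_squares w) && pairwise_nonequiv A) #|A|.

(* Main.v *)
Require Import Defs.
From mathcomp Require Import all_boot.
From mathcomp Require Import all_fingroup zify.

(** A partial injection of a finite alphabet extends to a permutation, so a
    parameterized square is a word [u ++ map s u] for some permutation [s], and
    two words are equivalent iff a permutation maps one to the other.  Attach to
    each square [y] the last position [i] at which a word equivalent to [y]
    occurs, together with a permutation [s] witnessing that the occurrence at [i]
    is a square.  Following Fraenkel and Simpson, at most two lengths share the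
    same pair [(i, s)]: if squares of half-lengths [a < b < c] with the same
    permutation start at [i], then the shortest one reoccurs, up to equivalence,
    after [i].  This bounds the number of classes by [2 * n * sigma`!], and each
    class has at most [sigma`!] members. *)

Set Implicit Arguments.
Unset Strict Implicit.
Unset Printing Implicit Defensive.

Lemma perm_extend_in (T : finType) (f : T -> T) (u : seq T) :
  {in u &, injective f} -> exists s : {perm T}, {in u, s =1 f}.
Proof.
elim: u => [|x u IHu] f_inj; first by exists 1%g.
have [|s sE] := IHu.
  by move=> y z yu zu; apply: f_inj; rewrite inE ?yu ?zu orbT.
have [xu|xNu] := boolP (x \in u).
  by exists s => y; rewrite inE => /predU1P[->|]; apply: sE.
(* The transposition corrects the image of [x] and fixes [s y] for [y] in [u]: [s y] differs from
   [s x] because [y] differs from [x], and equals [f y], which differs from [f x]. *)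
exists (s * tperm (s x) (f x))%g => y; rewrite inE permM.
case/predU1P=> [->|yu]; first by rewrite tpermL.
have xy : x != y by apply: contraNneq xNu => ->.
rewrite tpermD ?(inj_eq perm_inj) // sE //.
apply: contraNneq xy => /f_inj -> //; by rewrite inE ?eqxx ?yu ?orbT.
Qed.

Lemma param_equiv_permP (T : finType) (u v : seq T) :
  reflect (exists s : {perm T}, v = map s u) (param_equiv u v).
Proof.
apply: (iffP idP) => [/andP[_ /existsP[f /and3P[/dinjectiveP f_inj _ /eqP ->]]]|].
  have [|s sE] := @perm_extend_in T f u.
    by move=> x y xu yu; apply: f_inj; rewrite inE.
  by exists s; apply/eq_in_map => x xu; rewrite sE.
move=> [s ->]; apply/param_equivP; split; first by rewrite size_map.
exists s; split=> [x y _ _||x0 t tu]; first exact: perm_inj.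
  apply/setP => y; rewrite inE; apply/imsetP/mapP => -[x].
    by rewrite inE => xu ->; exists x.
  by move=> xu ->; exists x; rewrite ?inE.
by rewrite (nth_map x0).
Qed.

(* Case c < 2a of the three-squares argument: the word is genuinely periodic,
   with period the smaller of the two gaps b - a and c - b. *)
Lemma three_twisted_squares_period (T : Type) (f : T -> T) (X : nat -> T)
    (a b c : nat) :
    injective f -> a < b -> b < c -> c <= 2 * a ->
    (forall j, j < a -> X (j + a) = f (X j)) ->
    (forall j, j < b -> X (j + b) = f (X j)) ->
    (forall j, j < c -> X (j + c) = f (X j)) ->
  exists d, [/\ 0 < d, d <= c - a & forall j, j < 2 * a -> X (j + d) = X j].
Proof.
move=> f_inj ab bc c2a Xa Xb Xc.
have [le12|lt21] := leqP (b - a) (c - b).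
  exists (b - a); split; [lia|lia|].
  have upper j : a <= j < 2 * a -> X (j + (b - a)) = X j.
    move=> ja; have -> : j + (b - a) = (j - a) + b by lia.
    rewrite Xb; last by lia.
    by rewrite -Xa; [congr X|]; lia.
  have lower j : j + (b - a) < a -> X (j + (b - a)) = X j.
    move=> ja; apply: f_inj; rewrite -!Xa; [|lia|lia].
    by have := upper (j + a) ltac:(lia); rewrite addnAC.
  move=> j j2a; have [aj|ja] := leqP a j; first by apply: upper; lia.
  have [aj'|] := leqP a (j + (b - a)); last exact: lower.
  (* The pair [j], [j + (b - a)] straddles [a]. Shifting it forward by [b] and back by [c] lands in
     the range of [lower], since [c <= 2 * a] and [b - a <= c - b]. *)
  apply: f_inj; rewrite -!Xb; [|lia|lia].
  have -> : X (j + b) = X ((j + b - c) + c) by congr X; lia.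
  have -> : j + (b - a) + b = (j + b - c) + (b - a) + c by lia.
  rewrite !Xc; [|lia|lia].
  by rewrite lower //; lia.
exists (c - b); split; [lia|lia|].
have upper j : b <= j < 2 * b -> X (j + (c - b)) = X j.
  move=> jb; have -> : j + (c - b) = (j - b) + c by lia.
  rewrite Xc; last by lia.
  by rewrite -Xb; [congr X|]; lia.
have lower j : j + (c - b) < b -> X (j + (c - b)) = X j.
  move=> jb; apply: f_inj; rewrite -!Xb; [|lia|lia].
  by have := upper (j + b) ltac:(lia); rewrite addnAC.
move=> j j2a; have [bj|jb] := leqP b j; first by apply: upper; lia.
have [bj'|] := leqP b (j + (c - b)); last exact: lower.
(* The straddling pair is pulled back by [a]; here [c - b < b - a] gives [a <= j]. *)
have -> : X j = X ((j - a) + a) by congr X; lia.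
have -> : j + (c - b) = (j - a + (c - b)) + a by lia.
rewrite !Xa; [|lia|lia].
by rewrite lower //; lia.
Qed.

(** If [2 * a < c], the shortest square lies in the first half of the longest, and [s] copies it
    into the second half. The bound [d + 2 * a <= 2 * c] keeps the copy inside the longest
    square. *)
Lemma three_twisted_squares_reoccur (T : finType) (s : {perm T})
    (X : nat -> T) (a b c : nat) :
    a < b -> b < c ->
    (forall j, j < a -> X (j + a) = s (X j)) ->
    (forall j, j < b -> X (j + b) = s (X j)) ->
    (forall j, j < c -> X (j + c) = s (X j)) ->
  exists (d : nat) (t : {perm T}), [/\ 0 < d <= c, d + 2 * a <= 2 * c
    & forall j, j < 2 * a -> X (j + d) = t (X j)].
Proof.
move=> ab bc Xa Xb Xc; have [c2a|c2a] := leqP c (2 * a).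
  have [d [d0 dca Xd]] :=
    three_twisted_squares_period (@perm_inj _ s) ab bc c2a Xa Xb Xc.
  by exists d, 1%g; split=> [||j ja]; [lia|lia|rewrite perm1 Xd].
by exists c, s; split=> [||j ja]; [lia|lia|apply: Xc; lia].
Qed.

(** Double counting of the pairs related by [R]; an element may have several indices, so none has to
    be chosen. *)
Lemma card_le_fibers (I J : finType) (A : {set I}) (R : J -> I -> bool)
    (k : nat) :
    (forall x, x \in A -> exists p, R p x) ->
    (forall p, #|[set x in A | R p x]| <= k) ->
  #|A| <= k * #|J|.
Proof.
move=> A_hit fiber_le.
have A_le : #|A| <= \sum_(x in A) \sum_(p : J | R p x) 1.
  rewrite -sum1_card leq_sum // => x /A_hit[p Rpx].
  by rewrite (bigD1 p).
apply: leq_trans A_le _.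
rewrite (exchange_big_dep predT) //= mulnC -sum_nat_const leq_sum // => p _.
apply: leq_trans (fiber_le p); rewrite sum1_card.
by apply: eq_leq; apply: eq_card => x; rewrite !inE.
Qed.

Section LastOccurrence.
Variables (T : finType) (x0 : T) (w : seq T).
Implicit Types (y : seq T) (s t : {perm T}).

(** The permutation goes from the factor of [w] to [y]. Equality of sizes excludes a factor
    truncated by the end of [w]. *)
Definition occurs_at y t i := y == map t (take (size y) (drop i w)).

Lemma occurs_atP y t i :
  reflect (size y <= size w - i /\
           forall j, j < size y -> nth x0 y j = t (nth x0 w (i + j)))
          (occurs_at y t i).
Proof.
apply: (iffP eqP) => [yE|[le_y yE]].
  have le_y : size y <= size w - i.
    by move/(congr1 size): yE; rewrite size_map size_take_min size_drop => ->; apply: geq_minr.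
  split=> // j jy; rewrite {1}yE (nth_map x0) ?nth_take ?nth_drop //.
  by rewrite size_take_min size_drop; lia.
have szE : size (take (size y) (drop i w)) = size y.
  by rewrite size_take_min size_drop; lia.
apply: (@eq_from_nth _ x0) => [|j jy]; first by rewrite size_map szE.
by rewrite yE // (nth_map x0) ?szE // nth_take ?nth_drop.
Qed.

(** The square condition is imposed on [w] at [i], not on [y], so that squares sharing [i] and [s]
    obey recurrences with the same permutation, whatever [t] is. *)
Definition last_square_at i s y :=
  [&& ~~ odd (size y), [exists t, occurs_at y t i],
      [forall k : 'I_(size w), (i < k) ==> ~~ [exists t, occurs_at y t k]]
    & [forall j : 'I_(size y)./2,
        nth x0 w (i + j + (size y)./2) == s (nth x0 w (i + j))]].

Lemma no_three_last_squares i s y1 y2 y3 :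
    last_square_at i s y1 -> last_square_at i s y2 -> last_square_at i s y3 ->
  size y1 < size y2 -> size y2 < size y3 -> False.
Proof.
have halfP y : last_square_at i s y ->
    [/\ size y = 2 * (size y)./2, size y <= size w - i
      & forall j, j < (size y)./2 ->
          nth x0 w (i + (j + (size y)./2)) = s (nth x0 w (i + j))].
  case/and4P=> ev /existsP[t /occurs_atP[le_y _]] _ /forallP sq; split=> //.
    by rewrite mul2n even_halfK.
  by move=> j ja; have /eqP := sq (Ordinal ja); rewrite addnA.
move=> L1 L2 L3 lt12 lt23.
have [e1 l1 X1] := halfP _ L1; have [e2 l2 X2] := halfP _ L2.
have [e3 l3 X3] := halfP _ L3.
have lt_ab : (size y1)./2 < (size y2)./2 by lia.
have lt_bc : (size y2)./2 < (size y3)./2 by lia.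
have [d [r [/andP[d0 dc] dle Xd]]] := @three_twisted_squares_reoccur T s
  (fun j => nth x0 w (i + j)) _ _ _ lt_ab lt_bc X1 X2 X3.
(* As [d] is at most half the size of [y3], this holds even for an empty [y1]. *)
have id_lt : i + d < size w by lia.
case/and4P: L1 => _ /existsP[t /occurs_atP[_ yE]] /forallP later _.
have := later (Ordinal id_lt); rewrite /= -[X in X < _]addn0 ltn_add2l d0 /=.
case/negP; apply/existsP; exists (r^-1 * t)%g; apply/occurs_atP.
split=> [|j jy]; first by lia.
rewrite permM yE // -addnA (addnC d) Xd; last by lia.
by rewrite permK.
Qed.

Lemma last_square_exists y : infix y w -> param_square y ->
  exists (i : 'I_(size w)) s, last_square_at i s y.
Proof.
move=> y_in /param_squareP[u [v [u0 _ yE /param_equiv_permP[s vE]]]].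
have [p [q wE]] : exists p q : seq T, w = p ++ y ++ q by apply/infixP.
have szy : size y = 2 * size u by rewrite yE vE size_cat size_map; lia.
have u_gt0 : 0 < size u by case: u u0 {yE vE szy}.
have szw : size w = size p + (size y + size q) by rewrite wE !size_cat.
have p_lt : size p < size w by lia.
have occ_p : [exists t, occurs_at y t (Ordinal p_lt)].
  apply/existsP; exists 1%g; apply/occurs_atP => /=; split.
    by lia.
  move=> j jy; rewrite perm1 wE nth_cat ifF; last by lia.
  by rewrite addKn nth_cat jy.
pose P := [pred k : 'I_(size w) | [exists t, occurs_at y t k]].
have [i /existsP[t occ_i] i_max] := @arg_maxnP _ (Ordinal p_lt) P val occ_p.
(* On the factor at [i], which [t] maps to [y], the halves are related by a conjugate of [s];
   products act from left to right. *)
exists i, (t * s * t^-1)%g; apply/and4P; split.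
- by rewrite szy mul2n odd_double.
- by apply/existsP; exists t.
- apply/forallP => k; apply/implyP => ik; apply/negP => /i_max /=; lia.
have [_ yt] := occurs_atP _ _ _ occ_i.
have -> : (size y)./2 = size u by rewrite szy mul2n doubleK.
apply/forallP => j; have ju := ltn_ord j; rewrite !permM.
rewrite -yt; last by lia.
rewrite -(inj_eq (@perm_inj _ t)) -addnA -yt; last by lia.
rewrite permKV yE vE !nth_cat ju ifF; last by lia.
by rewrite addnK (nth_map x0).
Qed.

Lemma card_last_squares_le2 n (F : {set n.-bseq T}) i s :
    (forall y : n.-bseq T, y \in F -> last_square_at i s y) ->
    {in F &, injective (fun y : n.-bseq T => size y)} ->
  #|F| <= 2.
Proof.
move=> F_last sz_inj; rewrite leqNgt; apply/card_gt2P.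
move=> [x [y [z [[xF yF zF] [xy yz zx]]]]].
have neq_sz (a b : n.-bseq T) : a \in F -> b \in F -> a != b -> size a != size b.
  by move=> aF bF; apply: contra_neq => /sz_inj ->.
move: (neq_sz _ _ xF yF xy) (neq_sz _ _ yF zF yz) (neq_sz _ _ zF xF zx).
have no3 (a b c : n.-bseq T) : a \in F -> b \in F -> c \in F ->
    size a < size b -> size b < size c -> False.
  move=> /F_last La /F_last Lb /F_last Lc.
  exact: no_three_last_squares La Lb Lc.
(* All six orders of the three distinct sizes are excluded. *)
have := no3 _ _ _ xF yF zF; have := no3 _ _ _ xF zF yF.
have := no3 _ _ _ yF xF zF; have := no3 _ _ _ yF zF xF.
have := no3 _ _ _ zF xF yF; have := no3 _ _ _ zF yF xF.
lia.
Qed.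

End LastOccurrence.

Lemma card_nonequiv_param_squares n sigma (w : n.-tuple 'I_sigma)
    (A : {set n.-bseq 'I_sigma}) :
    A \subset param_squares w -> pairwise_nonequiv A -> 0 < sigma ->
  #|A| <= 2 * sigma`! * n.
Proof.
move=> /subsetP A_sq /forall_inP A_ne sigma0; pose x0 := Ordinal sigma0.
pose R (p : 'I_(size w) * 'S_sigma) (y : n.-bseq 'I_sigma) :=
  last_square_at x0 w p.1 p.2 y.
have -> : 2 * sigma`! * n = 2 * #|{: 'I_(size w) * 'S_sigma}|.
  by rewrite card_prod card_ord card_Sn size_tuple (mulnC n) mulnA.
apply: (@card_le_fibers _ _ A R).
  move=> y /A_sq; rewrite inE => /andP[y_in y_sq].
  by have [i [s]] := last_square_exists x0 y_in y_sq; exists (i, s).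
move=> [i s]; apply: (@card_last_squares_le2 _ x0 w _ _ i s).
  by move=> y; rewrite inE => /andP[].
move=> x y; rewrite !inE => /andP[xA /and4P[_ /existsP[t /eqP xE] _ _]].
move=> /andP[yA /and4P[_ /existsP[r /eqP yE] _ _]] sz.
apply/eqP; have /forall_inP/(_ y yA) := A_ne x xA.
apply: contraTT => xy; rewrite xy negbK; apply/param_equiv_permP.
(* Having equal size, [x] and [y] are images of the same factor at [i], under [t] and [r]. *)
exists (t^-1 * r)%g; rewrite {1}yE xE -sz -map_comp.
by apply: eq_map => z /=; rewrite permM permK.
Qed.

(* Recording also the permutation from the last occurrence to the square itself
   separates equivalent squares, at the price of one more factor sigma`!. *)
Lemma card_param_squares n sigma (w : n.-tuple 'I_sigma) :
  0 < sigma -> #|param_squares w| <= 2 * sigma`! ^ 2 * n.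
Proof.
move=> sigma0; pose x0 := Ordinal sigma0.
pose R (p : 'I_(size w) * 'S_sigma * 'S_sigma) (y : n.-bseq 'I_sigma) :=
  last_square_at x0 w p.1.1 p.1.2 y && occurs_at w y p.2 p.1.1.
have -> : 2 * sigma`! ^ 2 * n = 2 * #|{: 'I_(size w) * 'S_sigma * 'S_sigma}|.
  by rewrite !card_prod card_ord !card_Sn size_tuple -mulnn; lia.
apply: (@card_le_fibers _ _ (param_squares w) R).
  move=> y; rewrite inE => /andP[y_in y_sq].
  have [i [s L]] := last_square_exists x0 y_in y_sq.
  by have /and4P[_ /existsP[t yt] _ _] := L; exists (i, s, t); apply/andP.
move=> [[i s] t]; apply: (@card_last_squares_le2 _ x0 w _ _ i s).
  by move=> y; rewrite inE => /andP[_ /andP[]].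
move=> x y; rewrite !inE => /andP[_ /andP[_ /eqP xE]].
move=> /andP[_ /andP[_ /eqP yE]] sz; apply: val_inj.
by rewrite /= [LHS]xE [RHS]yE sz.
Qed.

Theorem theorem28 (n sigma : nat) (hn : 0 < n) (hsigma : 0 < sigma) :
  SQ'_param n sigma <= 2 * sigma`! * n /\
  SQ_param n sigma <= 2 * sigma`! ^ 2 * n.
Proof.
split; apply/bigmax_leqP => w _; last exact: card_param_squares.
apply/bigmax_leqP => A /andP[A_sq A_ne].
exact: card_nonequiv_param_squares A_sq A_ne hsigma.
Qed.
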